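(* The Nakayama conjecture holds true for the class of Terwilliger algebras of quasi-thin schemes over any field. That is: let $R$ be any field, $S$ a quasi-thin association scheme on a nonempty finite set $X$, $x\in X$, and $\mathcal{T}=\mathcal{T}_R(x)$ the Terwilliger $R$-algebra of $S$ with respect to $x$; if $\mathcal{T}$ has infinite dominant dimension, then $\mathcal{T}$ is self-injective.
   Context: **Notation.** For $n\in\mathbb{N}$, $[n]=\{0,1,\ldots,n\}$. **Association schemes.** An association scheme (scheme) of size $d$ on a nonempty finite set $X$ is a partition $S=\{R_0,R_1,\ldots,R_d\}$ of $X\times X$ with all parts $R_i$ nonempty such that: (S1) $R_0=\{(x,x)\mid x\in X\}$; (S2) for each $i\in[d]$ there is $i'\in[d]$ with $R_{i'}=\{(x,y)\mid (y,x)\in R_i\}$; (S3) for $i,j,\ell\in[d]$ and $(x,y)\in R_\ell$, the number $p_{ij}^\ell:=|\{z\in X\mid (x,z)\in R_i,\ (z,y)\in R_j\}|$ does not depend on the choice of $(x,y)\in R_\ell$. The valency of $R_i$ is $k_i:=p_{ii'}^0$; it equals $|xR_i|$ for every $x\in X$, where $xR_i:=\{y\in X\mid (x,y)\in R_i\}$. The scheme $S$ is quasi-thin if $k_i\le 2$ for all $i\in[d]$. **Terwilliger algebra.** Let $M_X(R)$ be the algebra of $X\times X$ matrices over $R$, with matrix units $E_{yz}$. For $i\in[d]$, the adjacency matrix $A_i\in M_X(R)$ has $(y,z)$-entry $1$ if $(y,z)\in R_i$ and $0$ otherwise. For $x\in X$, put $E_i^*(x):=\sum_{y\in xR_i}E_{yy}$.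 The Terwilliger $R$-algebra $\mathcal{T}_R(x)$ of $S$ with respect to $x$ is the $R$-subalgebra of $M_X(R)$ generated by $A_0,\ldots,A_d,E_0^*(x),\ldots,E_d^*(x)$. **Dominant dimension and the Nakayama conjecture.** For an Artin algebra $A$ with minimal injective resolution $0\to{}_AA\to I_0\to I_1\to\cdots\to I_n\to\cdots$ of ${}_AA$, the dominant dimension of $A$ is the minimal nonnegative integer $n$ such that $I_n$ is not projective, and $\infty$ if no such $n$ exists. The Nakayama conjecture states that any finite-dimensional algebra over a field with infinite dominant dimension is self-injective. *)

(* Defs.v *)
From HB Require Import structures.
From mathcomp Require Import all_boot all_order all_algebra all_field.

Set Implicit Arguments.
Unset Strict Implicit.
Unset Printing Implicit Defensive.

Import GRing.Theory.
Local Open Scope ring_scope.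

(* The functions [converse] (i |-> i') and [inum] ((i, j, l) |-> p_ij^l) are
   determined by the relations, because these are nonempty and distinct. *)
Record scheme (X : finType) (d : nat) := Scheme {
  srel :> 'I_d.+1 -> {set X * X};
  converse : 'I_d.+1 -> 'I_d.+1;
  inum : 'I_d.+1 -> 'I_d.+1 -> 'I_d.+1 -> nat;
  srel_inj : injective srel;
  srel_partition : partition [set srel i | i : 'I_d.+1] [set: X * X];
  srel0 : srel ord0 = [set xy : X * X | xy.1 == xy.2];
  srel_converse : forall i,
    srel (converse i) = [set xy : X * X | (xy.2, xy.1) \in srel i];
  srel_inum : forall i j l (x y : X), (x, y) \in srel l ->
    #|[set z | ((x, z) \in srel i) && ((z, y) \in srel j)]| = inum i j l
}.

Definition valency (X : finType) (d : nat) (S : scheme X d) (i : 'I_d.+1) :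
  nat := inum S i (converse S i) ord0.

Definition quasi_thin (X : finType) (d : nat) (S : scheme X d) : Prop :=
  forall i : 'I_d.+1, (valency S i <= 2)%N.

(* X x X matrices are represented in 'M_n.+1 with n.+1 = #|X|, which carries an
   F-algebra structure; the base point x witnesses that X is nonempty, and
   [point x] is a bijection from 'I_n.+1 onto X. *)
Definition point (X : finType) (x : X) (k : 'I_#|X|.-1.+1) : X :=
  nth x (enum X) k.

Lemma point_bij (X : finType) (x : X) : bijective (@point X x).
Proof.
have cX : #|X|.-1.+1 = #|X| by apply: prednK; apply/card_gt0P; exists x.
apply: inj_card_bij; last by rewrite card_ord cX.
have lt_enum (k : 'I_#|X|.-1.+1) : (k < size (enum X))%N.
  by rewrite -cardE; apply: leq_trans (ltn_ord k) (eq_leq cX).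
move=> i j eq_ij; apply/val_inj/eqP.
by rewrite -(nth_uniq x (lt_enum i) (lt_enum j) (enum_uniq X)); apply/eqP.
Qed.

Section Terwilliger.
Variables (F : fieldType) (X : finType) (d : nat) (S : scheme X d) (x : X).

Definition adjacency (i : 'I_d.+1) : 'M[F]_#|X|.-1.+1 :=
  \matrix_(k, l) ((point x k, point x l) \in S i)%:R.

Definition dual_idempotent (i : 'I_d.+1) : 'M[F]_#|X|.-1.+1 :=
  \sum_(k | (x, point x k) \in S i) delta_mx k k.

Definition terwilliger : {aspace 'M[F]_#|X|.-1.+1} :=
  << <<[seq adjacency i | i : 'I_d.+1] ++
       [seq dual_idempotent i | i : 'I_d.+1]>> >>%AS.

Definition terwilliger_algebra : falgType F := subvs_of terwilliger.

End Terwilliger.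

Definition injective_module (A : nzRingType) (I : lmodType A) : Prop :=
  forall (M N : lmodType A) (f : {linear M -> N}) (g : {linear M -> I}),
    injective f -> exists h : {linear N -> I}, h \o f =1 g.

Definition projective_module (A : nzRingType) (P : lmodType A) : Prop :=
  forall (M N : lmodType A) (f : {linear M -> N}) (g : {linear P -> N}),
    (forall v, exists u, f u = v) ->
    exists h : {linear P -> M}, f \o h =1 g.

(* Every nonzero submodule of N meets the image of f nontrivially. *)
Definition essential_image (A : nzRingType) (M N : lmodType A)
    (f : {linear M -> N}) : Prop :=
  forall U : {pred N}, submod_closed U ->
    (exists2 u, u \in U & u != 0) ->
    exists m, f m \in U /\ f m != 0.

(* 0 -> A -> I_0 -> I_1 -> ... exact with injective terms; minimality says that
   each I_n is an injective envelope of the submodule that the preceding map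
   hits. *)
Record min_injective_resolution (A : nzRingType) := MinInjectiveResolution {
  term : nat -> lmodType A;
  coaug : {linear A^o -> term 0%N};
  diff : forall n, {linear term n -> term n.+1};
  term_injective : forall n, injective_module (term n);
  coaug_inj : injective coaug;
  coaug_exact : forall v, diff 0%N v = 0 <-> exists a, coaug a = v;
  diff_exact : forall n v, diff n.+1 v = 0 <-> exists u, diff n u = v;
  coaug_essential : essential_image coaug;
  diff_essential : forall n, essential_image (diff n)
}.

(* [None] stands for infinity; minimal injective resolutions are unique up to
   isomorphism, so at most one value satisfies this. *)
Definition has_dominant_dimension (A : nzRingType) (n : option nat) : Prop :=
  exists I : min_injective_resolution A,
    if n is Some m then
      ~ projective_module (term I m) /\
      forall k, (k < m)%N -> projective_module (term I k)
    else forall k, projective_module (term I k).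

Definition self_injective (A : nzRingType) : Prop := injective_module A^o.

(* Main.v *)
Require Import Defs.
From HB Require Import structures.
From mathcomp Require Import all_boot all_order all_algebra all_field.
From mathcomp Require Import boolp ring.
From mathcomp Require Import freeg.

Set Implicit Arguments.
Unset Strict Implicit.
Unset Printing Implicit Defensive.

Import GRing.Theory.
Local Open Scope ring_scope.

(** Write [T] for the Terwilliger algebra at [x] and call the sets x R_i
    classes; in a quasi-thin scheme they have one or two points.  Let [swap]
    exchange the two points of each two-point class and fix the other points.
    Double counting shows that the relations are invariant under [swap]
    ([srel_swap]), so every matrix of [T] commutes with it
    ([terwilliger_swap]).  Moreover [T] contains the all-ones block
    [block i j] of any two classes and is stable under transposition.  Whether
    the valencies vanish in [F] now decides everything.

    If no valency vanishes in [F], each diagonal idempotent E_i splits into a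
    [swap]-symmetric and a [swap]-antisymmetric part in [T].  A matrix between
    two classes that has a given sign under [swap] is unique up to a scalar,
    so the left ideal generated by such a part is zero or minimal
    ([signed_minimal]).  Hence [T] is a sum of minimal left ideals and has no
    proper essential extension: in any minimal injective resolution [T] is
    isomorphic to I_0, thus injective ([self_injective_of_valency_neq0]).

    Otherwise [F] has characteristic 2 and some class c has two points.
    Let 0 be the class of [x] and K, J, e the all-ones blocks (0, c), (c, 0),
    (0, 0).  Then K J = 0, while left multiplication by J is injective on e T,
    and therefore on e P for every projective module P
    ([projective_regular]).  By injectivity of I_0 and I_1 one solves K y = e
    with y in E_c I_0, then J w = d y with w in e I_1.  If I_2 is projective,
    then J d w = 0 implies d w = 0; so w = d w', and J w' - y lies in [T].
    Multiplying by K gives e = K a with a in [T].  This is impossible, because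
    the entry of K a at ([x], [x]) is a sum of two terms that [swap] identifies,
    hence 0.  So the dominant dimension is at most 2
    ([third_term_not_projective]). *)

(** * Injective and projective modules *)

Section ImageSubmodule.
Variables (A : nzRingType) (L N : lmodType A) (f : {linear L -> N}).

Definition image_pred : {pred N} := fun n => `[< exists l, f l = n >].

Lemma image_pred_closed : submod_closed image_pred.
Proof.
split; first by apply/asboolP; exists 0; rewrite linear0.
move=> a u v /asboolP[l <-] /asboolP[m <-].
by apply/asboolP; exists (a *: l + m); rewrite linearP.
Qed.

HB.instance Definition _ :=
  GRing.isSubmodClosed.Build A N image_pred image_pred_closed.

Record image := Image { image_val :> N; image_valP : image_val \in image_pred }.

HB.instance Definition _ := [isSub for image_val].
HB.instance Definition _ := [Choice of image by <:].
HB.instance Definition _ := [SubChoice_isSubLmodule of image by <:].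

End ImageSubmodule.

(** The condition on kernels makes [g] factor through the image of [f]; the
    injectivity of [I] extends this factor from the image to all of [N]. *)
Lemma injective_factor (A : nzRingType) (I L N : lmodType A)
    (f : {linear L -> N}) (g : {linear L -> I}) :
  injective_module I -> (forall l, f l = 0 -> g l = 0) ->
  exists h : {linear N -> I}, h \o f =1 g.
Proof.
move=> injI kerfg.
have [l0 l0E] := choice (fun m : image f => asboolW (image_valP m)).
pose g' (m : image f) : I := g (l0 m).
have g'E (m : image f) l : f l = val m -> g' m = g l.
  move=> flm; apply/eqP; rewrite -subr_eq0 -linearB /=; apply/eqP/kerfg.
  by rewrite linearB /= flm l0E subrr.
have g'lin : linear g'.
  move=> a u v.
  by rewrite (g'E _ (a *: l0 u + l0 v)) ?linearP ?l0E.
pose G : {linear image f -> I} :=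
  HB.pack g' (GRing.isLinear.Build A _ _ _ g' g'lin).
have [h hG] := injI _ _ (val : {linear image f -> N}) G val_inj.
exists h => l /=.
have fl : f l \in image_pred f by apply/asboolP; exists l.
have := hG (Image fl); rewrite /= => ->.
exact: g'E.
Qed.

(** Compare right multiplication by [a] with [b |-> b *: u] on the regular
    module; [v] is the image of 1 under the factorization. *)
Lemma injective_divide (A : nzRingType) (I : lmodType A) (a : A) (u : I) :
  injective_module I -> (forall b, b * a = 0 -> b *: u = 0) ->
  exists v : I, a *: v = u.
Proof.
move=> injI annau.
have lina : linear (fun b : A^o => b * a : A^o).
  by move=> c b b'; rewrite mulrDl -scalerAl.
have linu : linear (fun b : A^o => b *: u).
  by move=> c b b'; rewrite scalerDl scalerA.
pose fa : {linear A^o -> A^o} := HB.pack (fun b : A^o => b * a : A^o)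
  (GRing.isLinear.Build A _ _ _ _ lina).
pose gu : {linear A^o -> I} := HB.pack (fun b : A^o => b *: u)
  (GRing.isLinear.Build A _ _ _ _ linu).
have [h hE] := injective_factor (f := fa) (g := gu) injI annau.
exists (h 1); rewrite -linearZ /=.
have := hE 1; rewrite /= mul1r scale1r => <-.
by congr (h _); apply: mulr1.
Qed.

(** The identity of [P] lifts to the free module on the set of all elements
    of [P], where the implication can be checked coefficient by coefficient. *)
Lemma projective_regular (A : nzRingType) (P : lmodType A) (a b : A) :
  projective_module P -> (forall t, a * t = 0 -> b * t = 0) ->
  forall u : P, a *: u = 0 -> b *: u = 0.
Proof.
move=> projP regab u au0.
pose eval := fglift (id : P -> P).
have eval_sub : {morph eval : D D' / D - D'} := @lift_is_additive A P P id.
have eval0 : eval 0 = 0 by rewrite -(subrr 0) eval_sub subrr.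
have evalN : {morph eval : D / - D}.
  by move=> D; rewrite -[in LHS](sub0r D) eval_sub eval0 sub0r.
have evalD : {morph eval : D D' / D + D'}.
  by move=> D D'; rewrite -{1}[D']opprK eval_sub evalN opprK.
have eval_lin : linear eval.
  move=> c D D'; rewrite evalD; congr (_ + _).
  have -> : c *: D = \sum_(p <- dom D) << c * coeff p D *g p >> by [].
  rewrite -[in RHS](freeg_sumE D) !(big_morph eval evalD eval0) scaler_sumr.
  by apply: eq_bigr => p _; rewrite /eval !liftU scalerA.
pose ev : {linear {freeg P / A} -> P} := HB.pack eval
  (GRing.isLinear.Build A _ _ _ _ eval_lin).
have surj p : exists D, ev D = p.
  by exists << p >>; rewrite /= /eval liftU scale1r.
have [h hE] := projP _ _ ev (idfun : {linear P -> P}) surj.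
have hu0 : b *: h u = 0.
  apply/eqP/freeg_eqP => p; rewrite coeffZ coeff0; apply: regab.
  by rewrite -coeffZ -linearZ /= au0 linear0 coeff0.
by have := hE (b *: u); rewrite /= linearZ /= hu0 eval0 => <-.
Qed.

(** In the term of index 0, [K *: y = e] is solvable by the first hypothesis;
    the image of [ec *: y] in the next term is killed by [K], so by the second
    hypothesis it is [J *: w] for some [w] there.  Projectivity of the term of
    index 2 and regularity of [J] make [e *: w] a boundary, the image of some
    [w'].  The cocycle [J *: w' - ec *: y] then comes from the algebra, and
    multiplying it by [K] exhibits [e] as a right multiple of [K]. *)
Lemma third_term_not_projective_of_divisors (A : nzRingType)
    (I : min_injective_resolution A) (K J e ec : A) :
  (forall b, b * K = 0 -> b * e = 0) ->
  (forall b, b * J = 0 -> exists b', b * ec = b' * K) ->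
  K * ec = K -> J * e = J -> K * J = 0 ->
  (forall t, J * t = 0 -> e * t = 0) ->
  (forall t, K * t <> e) ->
  ~ projective_module (term I 2).
Proof.
move=> annK annJ Kec Je KJ regJ notKe projI2.
have coaugZ a b : a *: coaug I b = coaug I (a * b) by rewrite -linearZ.
have d0coaug a : diff I 0 (coaug I a) = 0 by apply/coaug_exact; exists a.
have [y Ky] : exists y : term I 0, K *: y = coaug I e.
  apply: injective_divide; first exact: term_injective.
  by move=> b /annK be0; rewrite coaugZ be0; apply: linear0.
have [w Jw] : exists w : term I 1, J *: w = diff I 0 (ec *: y).
  apply: injective_divide; first exact: term_injective.
  move=> b /annJ[b' becK]; rewrite linearZ scalerA becK -scalerA -linearZ /=.
  by rewrite Ky d0coaug scaler0.
have d1w : J *: diff I 1 w = 0.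
  by rewrite -linearZ /= Jw; apply/diff_exact; eexists.
have [w' d0w'] : exists w', diff I 0 w' = e *: w.
  apply/diff_exact.
  by rewrite linearZ; apply: (projective_regular projI2 regJ).
have [a aE] : exists a, coaug I a = J *: w' - ec *: y.
  apply/coaug_exact.
  by rewrite linearB linearZ /= d0w' scalerA Je Jw subrr.
apply: (notKe (- a)); apply: (coaug_inj (m := I)).
rewrite mulrN [LHS]linearN /= -coaugZ aE scalerBr !scalerA KJ Kec scale0r sub0r.
by rewrite opprK.
Qed.

(** Each nonzero [e t] generates a minimal left ideal.  For [v] in [N], the
    submodule [A e_t v] is then simple or zero, so essentiality forces it into
    the image, and [v] is the sum of the [e_t v]. *)
Lemma essential_image_surjective (A : nzRingType) (M N : lmodType A)
    (f : {linear M -> N}) (T : finType) (e : T -> A) :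
  \sum_t e t = 1 ->
  (forall t a, a * e t != 0 -> exists c, c * (a * e t) = e t) ->
  essential_image f -> forall v, exists u, f u = v.
Proof.
move=> sum_e min_e ess_f v.
suff im_ev t : exists u, f u = e t *: v.
  have [u uE] := choice im_ev; exists (\sum_t u t); rewrite linear_sum.
  by under eq_bigr do rewrite uE; rewrite -scaler_suml sum_e scale1r.
pose U : {pred N} := fun u => `[< exists a, u = a *: (e t *: v) >].
have Ua a : a *: (e t *: v) \in U by apply/asboolP; exists a.
have closedU : submod_closed U.
  split; first by rewrite -(scale0r (e t *: v)) Ua.
  by move=> c _ _ /asboolP[a ->] /asboolP[b ->];
    rewrite [c *: _]scalerA -scalerDl Ua.
have [-> | ev0] := eqVneq (e t *: v) 0; first by exists 0; rewrite linear0.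
have [|m [/asboolP[a fm] fm0]] := ess_f U closedU.
  by exists (e t *: v) => //; rewrite -[X in X \in _]scale1r Ua.
have [|c cE] := min_e t a.
  by apply: contra_neq fm0 => ae0; rewrite fm scalerA ae0 scale0r.
by exists (c *: m); rewrite linearZ /= fm !scalerA cE.
Qed.

Lemma injective_of_bijection (A : nzRingType) (I M : lmodType A)
    (f : {linear M -> I}) :
  injective f -> (forall v, exists u, f u = v) ->
  injective_module I -> injective_module M.
Proof.
move=> injf surjf injI L N i g inji.
have [h hE] := injI _ _ i (f \o g) inji.
have [h' h'E] := choice (fun n => surjf (h n)).
have h'lin : linear h'.
  by move=> a u v; apply: injf; rewrite linearP !h'E linearP.
exists (HB.pack h' (GRing.isLinear.Build A _ _ _ h' h'lin) : {linear N -> M}).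
by move=> l /=; apply: injf; rewrite h'E; apply: hE.
Qed.

(** * Classes of points relative to the base point *)

Lemma srel_cover (X : finType) (d : nat) (S : scheme X d) (y z : X) :
  exists i, (y, z) \in S i.
Proof.
have := in_setT (y, z); rewrite -(cover_partition (srel_partition S)).
by case/bigcupP => _ /imsetP[i _ ->]; exists i.
Qed.

Lemma srel_unique (X : finType) (d : nat) (S : scheme X d) (y z : X) i j :
  (y, z) \in S i -> (y, z) \in S j -> i = j.
Proof.
have [_ /trivIsetP tiS _] := and3P (srel_partition S).
move=> Si Sj; apply: srel_inj (S) _ _ _; apply: contraTeq Sj => neqij.
have := tiS _ _ (imset_f _ isT) (imset_f _ isT) neqij.
by move/disjoint_setI0/setP/(_ (y, z)); rewrite !inE Si /= => ->.
Qed.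

Lemma srel_converseE (X : finType) (d : nat) (S : scheme X d) (y z : X) i :
  ((y, z) \in S (converse S i)) = ((z, y) \in S i).
Proof. by rewrite srel_converse inE. Qed.

Section Classes.
Variables (X : finType) (d : nat) (S : scheme X d) (x : X).
Local Notation n := #|X|.-1.+1.
Local Notation pt := (point x).

Definition class (k : 'I_n) : 'I_d.+1 :=
  odflt ord0 [pick i | (x, pt k) \in S i].

Lemma class_eqE k i : (class k == i) = ((x, pt k) \in S i).
Proof.
rewrite /class; case: pickP => [j Sj | noS] /=.
  by apply/eqP/idP => [<- // | Si]; apply: srel_unique Sj Si.
by have [j] := srel_cover S x (pt k); rewrite noS.
Qed.

Lemma card_point (P : pred X) : #|[set k : 'I_n | P (pt k)]| = #|[set z | P z]|.
Proof.
have [q ptK qK] := point_bij x.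
rewrite -(card_imset _ (can_inj ptK)); apply: eq_card => z; rewrite inE.
apply/imsetP/idP => [[k] | Pz]; first by rewrite inE => Pk ->.
by exists (q z); rewrite ?inE qK.
Qed.

Lemma card_class k : #|[set m | class m == class k]| = valency S (class k).
Proof.
rewrite /valency -(@srel_inum _ _ S _ _ _ x x); last by rewrite srel0 inE.
rewrite -card_point; apply: eq_card => m.
by rewrite !inE srel_converseE andbb class_eqE.
Qed.

(** Intersection numbers seen from [x]: the bipartite graph that a relation
    induces between two classes is biregular. *)
Lemma card_class_srel l i k k' : class k = class k' ->
  #|[set m | (class m == i) && ((pt m, pt k) \in S l)]| =
  #|[set m | (class m == i) && ((pt m, pt k') \in S l)]|.
Proof.
have inumE m : (x, pt m) \in S (class m) by rewrite -class_eqE.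
have toinum m : #|[set m' | (class m' == i) && ((pt m', pt m) \in S l)]| =
                inum S i l (class m).
  rewrite -(srel_inum i l (inumE m)) -card_point; apply: eq_card => m'.
  by rewrite !inE class_eqE.
by move=> kk'; rewrite !toinum kk'.
Qed.

Definition swap (k : 'I_n) : 'I_n :=
  odflt k [pick m | (m != k) && (class m == class k)].

Lemma class_swap k : class (swap k) = class k.
Proof. by rewrite /swap; case: pickP => //= m /andP[_ /eqP]. Qed.

Hypothesis thinS : quasi_thin S.

Lemma classP k m : class m = class k -> m = k \/ m = swap k.
Proof.
have [-> | neq_mk] := eqVneq m k; [by left | move=> cmk; right].
rewrite /swap; case: pickP => [m' /andP[neq_m'k /eqP cm'k] | /(_ m)] /=; last first.
  by rewrite neq_mk cmk eqxx.
apply/eqP; apply: contraT => neq_mm'.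
have := thinS (class k); rewrite -card_class leqNgt => /negP[].
have : uniq [:: m; m'; k] by rewrite /= !inE negb_or neq_mm' neq_mk neq_m'k.
move/card_uniqP; rewrite -[3%N]/(size [:: m; m'; k]) => <-.
apply/subset_leq_card/subsetP => u.
by rewrite !inE => /or3P[] /eqP->; rewrite ?cmk ?cm'k.
Qed.

Lemma swapK : involutive swap.
Proof.
move=> k; have [//|_] := classP (etrans (class_swap (swap k)) (class_swap k)).
by case: (classP (esym (class_swap k))) => e; rewrite -!e.
Qed.

Lemma big_class (R : nmodType) (f : 'I_n -> R) k :
  \sum_(m | class m == class k) f m =
  f k + (if swap k == k then 0 else f (swap k)).
Proof.
rewrite (bigD1 k) //=; congr (_ + _); have [e | neq] := eqVneq (swap k) k.
  by rewrite big_pred0 // => m; apply/andP => -[/eqP/classP[]->]; rewrite ?e eqxx.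
rewrite (bigD1 (swap k)) ?class_swap ?eqxx ?neq //= big_pred0 ?addr0 // => m.
by apply/negP => /andP[/andP[/eqP/classP[]->]]; rewrite ?eqxx.
Qed.

(** Between two classes of at most two points a relation is a 0-1 block with
    constant row sums and constant column sums.  For a 2 x 2 block, adding
    the two equalities of sums gives twice the equality of opposite entries. *)
Lemma srel_swap l k m :
  ((pt (swap k), pt (swap m)) \in S l) = ((pt k, pt m) \in S l).
Proof.
pose r k m : nat := (pt k, pt m) \in S l.
have col k' m' m'' : class m' = class m'' ->
    (r k' m' + (if swap k' == k' then 0%N else r (swap k') m') =
     r k' m'' + (if swap k' == k' then 0%N else r (swap k') m''))%N.
  have big_r u : (r k' u + (if swap k' == k' then 0%N else r (swap k') u))%N =
      #|[set k | (class k == class k') && ((pt k, pt u) \in S l)]|.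
    rewrite -sum1dep_card big_mkcondr; apply: etrans (esym (big_class (r^~ u) _)) _.
    by apply: eq_bigr => v _; rewrite /r; case: (_ \in _).
  by move=> e; rewrite !big_r; apply: card_class_srel.
have row k' m' k'' : class k' = class k'' ->
    (r k' m' + (if swap m' == m' then 0%N else r k' (swap m')) =
     r k'' m' + (if swap m' == m' then 0%N else r k'' (swap m')))%N.
  have big_r u : (r u m' + (if swap m' == m' then 0%N else r u (swap m')))%N =
      #|[set m | (class m == class m') && ((pt m, pt u) \in S (converse S l))]|.
    rewrite -sum1dep_card big_mkcondr; apply: etrans (esym (big_class (r u) _)) _.
    by apply: eq_bigr => v _; rewrite srel_converseE /r; case: (_ \in _).
  by move=> e; rewrite !big_r; apply: card_class_srel.
have := col k m (swap m) (esym (class_swap m)).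
have := row k m (swap k) (esym (class_swap k)).
rewrite /r.
case: eqP => [-> | _]; case: eqP => [-> | _] //; do 4! case: (_ \in _) => //.
Qed.
End Classes.

(** * Matrices of the Terwilliger algebra *)

Section Matrices.
Variables (F : fieldType) (X : finType) (d : nat) (S : scheme X d) (x : X).
Hypothesis thinS : quasi_thin S.
Local Notation n := #|X|.-1.+1.
Local Notation pt := (point x).
Local Notation class := (class S x).
Local Notation swap := (swap S x).
Local Notation T := (terwilliger F S x).
Local Notation E := (dual_idempotent F S x).
Implicit Types (a b f : 'M[F]_n) (i j : 'I_d.+1) (k m : 'I_n).

Lemma valency_class k : valency S (class k) = (1 + (swap k != k))%N.
Proof.
rewrite -card_class -sum1dep_card.
apply: etrans (big_class x thinS (fun=> 1%N) k) _.
by case: (_ == _).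
Qed.

Lemma dual_idempotentE i k m : E i k m = ((k == m) && (class k == i))%:R.
Proof.
rewrite summxE; under eq_bigr do rewrite mxE.
rewrite class_eqE; case: (boolP ((x, pt k) \in S i)) => [Sk | nSk].
  rewrite (bigD1 k) //= eqxx /= eq_sym big1 ?addr0 ?andbT // => p /andP[_ neq].
  by rewrite eq_sym (negbTE neq).
rewrite andbF big1 // => p Sp; have [e|//] := eqVneq k p.
by rewrite e Sp in nSk.
Qed.

Lemma mul_dual_idempotent i b k m : (E i * b) k m = (class k == i)%:R * b k m.
Proof.
rewrite -mulmxE mxE (bigD1 k) //= big1 ?addr0 ?dual_idempotentE ?eqxx // => p neq.
by rewrite dual_idempotentE eq_sym (negbTE neq) mul0r.
Qed.

Lemma mulr_dual_idempotent i b k m : (b * E i) k m = b k m * (class m == i)%:R.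
Proof.
rewrite -mulmxE mxE (bigD1 m) //= big1 ?addr0 ?dual_idempotentE ?eqxx // => p neq.
by rewrite dual_idempotentE (negbTE neq) mulr0.
Qed.

Definition block i j : 'M[F]_n :=
  \matrix_(k, m) ((class k == i) && (class m == j))%:R.

Lemma mul_block i j b k m :
  (block i j * b) k m = (class k == i)%:R * \sum_(p | class p == j) b p m.
Proof.
rewrite -mulmxE mxE mulr_sumr [RHS]big_mkcond; apply: eq_bigr => p _.
by rewrite mxE; case: (class k == i); case: (class p == j); rewrite /= ?mul0r.
Qed.

Lemma mulr_block i j b k m :
  (b * block i j) k m = (\sum_(p | class p == i) b k p) * (class m == j)%:R.
Proof.
rewrite -mulmxE mxE mulr_suml [RHS]big_mkcond; apply: eq_bigr => p _.
by rewrite mxE; case: (class p == i); case: (class m == j); rewrite /= ?mulr0.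
Qed.

Lemma terwilliger1 : 1 \in T.
Proof. by rewrite memvE sub1_agenv. Qed.

Lemma terwilliger_mul a b : a \in T -> b \in T -> a * b \in T.
Proof. by move=> aT bT; apply: (subvP (asubv T)); apply: memv_mul. Qed.

Lemma adjacency_terwilliger i : adjacency F S x i \in T.
Proof.
apply: (subvP (sub_agenv _)); apply: memv_span.
by rewrite mem_cat map_f ?mem_enum.
Qed.

Lemma dual_idempotent_terwilliger i : E i \in T.
Proof.
apply: (subvP (sub_agenv _)); apply: memv_span.
by rewrite mem_cat orbC map_f ?mem_enum.
Qed.

(** Induction over the generators, which act by left multiplication. *)
Lemma terwilliger_sub (V : {vspace 'M[F]_n}) : 1 \in V ->
  (forall i b, b \in V -> adjacency F S x i * b \in V) ->
  (forall i b, b \in V -> E i * b \in V) ->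
  (T <= V)%VS.
Proof.
move=> V1 VA VE; apply: agenv_sub_modl; first by rewrite -memvE.
apply/prodvP => u v uU vV; have -> : u * v = amulr v u by rewrite lfunE.
rewrite memv_preim; move: u uU; apply/subvP/span_subvP => g.
rewrite mem_cat -memv_preim lfunE /=.
by case/orP => /mapP[i _ ->]; [apply: VA | apply: VE].
Qed.

(** The adjacency matrices sum to the all-ones matrix, which the diagonal
    idempotents cut into blocks. *)
Lemma block_terwilliger i j : block i j \in T.
Proof.
pose A := \sum_i adjacency F S x i.
have AT : A \in T by apply: memv_suml => l _; apply: adjacency_terwilliger.
have AE k m : A k m = 1.
  have [l Sl] := srel_cover S (pt k) (pt m).
  rewrite summxE (bigD1 l) //= mxE Sl big1 ?addr0 // => l' neq.
  rewrite mxE; case: (boolP (_ \in _)) => // Sl'.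
  by case/eqP: neq; apply: srel_unique Sl' Sl.
have -> : block i j = E i * A * E j.
  apply/matrixP => k m; rewrite mulr_dual_idempotent mul_dual_idempotent AE mxE.
  by rewrite mulr1 -natrM mulnb.
by do 2?apply: terwilliger_mul; rewrite ?dual_idempotent_terwilliger.
Qed.

(** Transposition is an anti-automorphism that permutes the generators. *)
Lemma terwilliger_tr b : b \in T -> b^T \in T.
Proof.
have trE c : (linfun (fun c : 'M[F]_n => c^T : 'M[F]_n)) c = c^T.
  by rewrite lfunE.
suff sTV : (T <= linfun (fun c : 'M[F]_n => c^T : 'M[F]_n) @^-1: T)%VS.
  by move/(subvP sTV); rewrite -memv_preim trE.
have mem c : (c \in linfun (fun c : 'M[F]_n => c^T : 'M[F]_n) @^-1: T)%VS =
  (c^T \in T) by rewrite -memv_preim trE.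
have trM (c c' : 'M[F]_n) : (c * c')^T = c'^T * c^T by apply: trmx_mul.
apply: terwilliger_sub => [|i c|i c]; rewrite !mem.
- by rewrite trmx1 terwilliger1.
- move=> cT; rewrite trM; apply: terwilliger_mul => //.
  suff -> : (adjacency F S x i)^T = adjacency F S x (converse S i).
    exact: adjacency_terwilliger.
  by apply/matrixP => k m; rewrite !mxE srel_converseE.
move=> cT; rewrite trM; apply: terwilliger_mul => //.
suff -> : (E i)^T = E i by apply: dual_idempotent_terwilliger.
apply/matrixP => k m; rewrite mxE !dual_idempotentE eq_sym.
by case: eqP => // ->.
Qed.

(** [T] lies in the centralizer of the permutation matrix [P] of [swap]. *)
Lemma terwilliger_swap b k m : b \in T -> b (swap k) m = b k (swap m).
Proof.
pose P : 'M[F]_n := \matrix_(k, m) (m == swap k)%:R.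
have mulP c p q : (P * c) p q = c (swap p) q.
  rewrite -mulmxE mxE (bigD1 (swap p)) //= mxE eqxx mul1r big1 ?addr0 // => r neq.
  by rewrite mxE (negbTE neq) mul0r.
have mulrP c p q : (c * P) p q = c p (swap q).
  rewrite -mulmxE mxE (bigD1 (swap q)) //= mxE (swapK x thinS) eqxx mulr1 big1.
    by rewrite addr0.
  by move=> r neq; rewrite mxE eq_sym (inv_eq (swapK x thinS)) (negbTE neq) mulr0.
suff sTC : (T <= 'C[P])%VS.
  move/(subvP sTC)/cent1vP/matrixP/(_ k m).
  by rewrite mulP mulrP => ->.
have centM c c' : c * P = P * c -> c' \in 'C[P]%VS -> c * c' \in 'C[P]%VS.
  move=> cP /cent1vP c'P; apply/cent1vP.
  by rewrite -mulrA c'P mulrA cP mulrA.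
apply: terwilliger_sub => [|i c|i c]; first exact: cent1v1.
  apply: centM; apply/matrixP => p q; rewrite mulP mulrP !mxE.
  by rewrite -(srel_swap x thinS) (swapK x thinS).
apply: centM; apply/matrixP => p q; rewrite mulP mulrP !dual_idempotentE.
by rewrite class_swap (inv_eq (swapK x thinS)).
Qed.

(** * Valencies invertible in the field *)

(** [f] lives on class [i] and [swap] multiplies it by [s] from both sides. *)
Definition signed (s : F) i f : Prop :=
  [/\ forall k m, f (swap k) m = s * f k m,
      forall k m, f k (swap m) = s * f k m,
      forall k m, class k != i -> f k m = 0 &
      forall k m, class m != i -> f k m = 0].

(** Applying [swap] to rows and columns carries the position [(k, k)] to
    every position of the diagonal block of [class k], so the entry there
    determines the whole matrix. *)
Lemma signed_proportional s f g k :
  signed s (class k) f -> signed s (class k) g -> g k k *: f = f k k *: g.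
Proof.
move=> [fl fr fl0 fr0] [gl gr gl0 gr0]; apply/matrixP => p q; rewrite !mxE.
have [/eqP/(classP thinS) ep | neq] := boolP (class p == class k); last first.
  by rewrite (fl0 _ _ neq) (gl0 _ _ neq) !mulr0.
have [/eqP/(classP thinS) eq | neq] := boolP (class q == class k); last first.
  by rewrite (fr0 _ _ neq) (gr0 _ _ neq) !mulr0.
by case: ep eq => -> [] ->; rewrite ?fl ?gl ?fr ?gr; ring.
Qed.

(** Take a nonzero entry of [a * f], in a row of the class of [k] say, and
    let [B] be the part of [a * f] in the rows of that class.  Then [B^T * B]
    is [signed] for the same [s] and [i], and its diagonal entry is the square
    of the chosen entry times the valency of the class of [k], so it is a
    nonzero matrix proportional to [f]. *)
Lemma signed_minimal s i f a :
  (forall k, (valency S (class k))%:R != 0 :> F) -> s * s = 1 ->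
  f \in T -> signed s i f -> a \in T -> a * f != 0 ->
  exists2 c, c \in T & c * (a * f) = f.
Proof.
move=> val0 ss fT sf aT; have [_ fr _ fr0] := sf.
have afr k m : (a * f) k (swap m) = s * (a * f) k m.
  rewrite -!mulmxE !mxE mulr_sumr; apply: eq_bigr => p _.
  by rewrite fr mulrCA.
have afr0 k m : class m != i -> (a * f) k m = 0.
  by move=> neq; rewrite -mulmxE mxE big1 // => p _; rewrite fr0 ?mulr0.
have afT := terwilliger_mul aT fT.
case/matrix0Pn => k [m af0].
have ci : class m = i by apply: contraNeq af0 => /afr0->.
(* [c0 * (a * f)] is B^T * B for [B := E (class k) * (a * f)]. *)
pose c0 := (E (class k) * (a * f))^T * E (class k).
have c0T : c0 \in T.
  by rewrite terwilliger_mul ?terwilliger_tr ?terwilliger_mul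
             ?dual_idempotent_terwilliger.
pose g := c0 * (a * f).
have gE p q : g p q = \sum_(u | class u == class k) (a * f) u p * (a * f) u q.
  rewrite /g -[LHS]/((c0 *m (a * f)) p q) mxE [RHS]big_mkcond; apply: eq_bigr => u _.
  rewrite mulr_dual_idempotent mxE mul_dual_idempotent.
  by case: (class u == class k); rewrite ?mulr1 ?mul1r ?mulr0 ?mul0r.
have sg : signed s i g.
  split=> p q; rewrite !gE.
  - by rewrite mulr_sumr; apply: eq_bigr => u _; rewrite afr mulrA.
  - by rewrite mulr_sumr; apply: eq_bigr => u _; rewrite afr mulrCA.
  - by move=> neq; rewrite big1 // => u _; rewrite (afr0 _ _ neq) mul0r.
  by move=> neq; rewrite big1 // => u _; rewrite (afr0 _ _ neq) mulr0.
have gm : g m m = (a * f) k m ^+ 2 * (valency S (class k))%:R.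
  rewrite gE (big_class x thinS) valency_class natrD (terwilliger_swap _ _ afT) afr.
  move: ((a * f) k m) => b; case: (swap k == k) => /=; first by ring.
  by rewrite mulrACA ss; ring.
have gm0 : g m m != 0 by rewrite gm mulf_neq0 ?expf_neq0.
exists ((f m m / g m m) *: c0); first by rewrite memvZ.
rewrite -ci in sf sg; rewrite -scalerAl -/g mulrC -scalerA.
by rewrite -(signed_proportional sf sg) scalerA mulVf ?scale1r.
Qed.

(** The projection of class [i] onto its [swap]-invariant vectors. *)
Definition sym_idempotent i : 'M[F]_n := (valency S i)%:R^-1 *: block i i.

Definition signed_idempotent (t : bool * 'I_d.+1) : 'M[F]_n :=
  if t.1 then sym_idempotent t.2 else E t.2 - sym_idempotent t.2.

Lemma signed_idempotent_terwilliger t : signed_idempotent t \in T.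
Proof.
have symT i : sym_idempotent i \in T by rewrite memvZ ?block_terwilliger.
by case: t => -[] i; rewrite /signed_idempotent //= memvB ?dual_idempotent_terwilliger.
Qed.

Lemma sum_signed_idempotent : \sum_t signed_idempotent t = 1.
Proof.
rewrite -(pair_bigA _ (fun s i => signed_idempotent (s, i))) /=.
rewrite big_bool /= -big_split /=.
apply/matrixP => k m; rewrite summxE (bigD1 (class k)) //= big1 => [|i neq].
  rewrite addr0 /signed_idempotent /= addrC subrK dual_idempotentE eqxx andbT.
  by rewrite -[1 in RHS]/(1%:M) mxE.
rewrite /signed_idempotent /= addrC subrK dual_idempotentE [class k == i]eq_sym.
by rewrite (negbTE neq) andbF.
Qed.

Lemma signed_idempotent_signed t :
  (forall k, (valency S (class k))%:R != 0 :> F) ->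
  signed ((-1) ^+ (~~ t.1)) t.2 (signed_idempotent t).
Proof.
move=> val0; have tT := signed_idempotent_terwilliger t.
have fr0 k m : class m != t.2 -> signed_idempotent t k m = 0.
  rewrite /signed_idempotent {tT}; case: t => -[] i /= neq.
    by rewrite !mxE (negbTE neq) andbF mulr0.
  rewrite !(dual_idempotentE, mxE) (negbTE neq) andbF mulr0 subr0.
  by case: eqP => // ->; rewrite (negbTE neq).
suff fl k m : signed_idempotent t (swap k) m =
    (-1) ^+ (~~ t.1) * signed_idempotent t k m.
  split=> // k m; first by rewrite -(terwilliger_swap _ _ tT).
  rewrite /signed_idempotent {tT fl fr0}; case: t => -[] i /= neq;
    by rewrite !(dual_idempotentE, mxE) (negbTE neq) ?andbF /= ?mulr0 ?subr0.
rewrite /signed_idempotent {tT fr0}; case: t => -[] i /=.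
  by rewrite !mxE class_swap expr0 mul1r.
rewrite !(dual_idempotentE, mxE) class_swap expr1 mulN1r.
have [<-|_] := eqVneq (class k) i; rewrite ?andbF /= ?mulr0 ?subr0 ?oppr0 //.
have [/(classP thinS)|neq] := eqVneq (class m) (class k); last first.
  have [e|_] := eqVneq k m; first by rewrite e eqxx in neq.
  have [e|_] := eqVneq (swap k) m; first by rewrite -e class_swap eqxx in neq.
  by rewrite mulr0 subr0 oppr0.
move: (val0 k); rewrite valency_class andbT.
have [e|neq] := eqVneq (swap k) k => /= v0 [] ->.
- by rewrite e eqxx invr1 /= !mulr1n; ring.
- by rewrite e eqxx invr1 /= !mulr1n; ring.
- by rewrite eqxx (negbTE neq) /= ?mulr1n mulr0n; field.
by rewrite eqxx eq_sym (negbTE neq) /= ?mulr1n mulr0n; field.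
Qed.

Lemma val_terwilliger_algebra1 :
  val (1 : terwilliger_algebra F S x) = 1.
Proof. by apply/eqP; rewrite -[_ == _]/(algid T == 1) algid_eq1 terwilliger1. Qed.

Lemma self_injective_of_valency_neq0 :
  (forall k, (valency S (class k))%:R != 0 :> F) ->
  min_injective_resolution (terwilliger_algebra F S x) ->
  self_injective (terwilliger_algebra F S x).
Proof.
move=> val0 I.
pose e t : terwilliger_algebra F S x := Subvs (signed_idempotent_terwilliger t).
have sum_e : \sum_t e t = 1.
  apply: val_inj; rewrite val_terwilliger_algebra1 -sum_signed_idempotent.
  exact: (linear_sum vsval).
have min_e t (a : terwilliger_algebra F S x) :
    a * e t != 0 -> exists c, c * (a * e t) = e t.
  move=> ae0; have ss : (-1) ^+ (~~ t.1) * (-1) ^+ (~~ t.1) = 1 :> F.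
    by case: t.1; rewrite ?mulr1 // mulrNN mulr1.
  have [c cT cE] := signed_minimal val0 ss (valP (e t))
    (signed_idempotent_signed t val0) (valP a) ae0.
  by exists (Subvs cT); apply: val_inj.
apply: injective_of_bijection (@coaug_inj _ I) _ (@term_injective _ I 0).
exact: essential_image_surjective sum_e min_e (@coaug_essential _ I).
Qed.

(** * A vanishing valency *)

(** If [b * J = 0], the two columns of [b] in class [c] are opposite, hence
    equal in characteristic 2.  Commutation with [swap] then makes them constant
    on each class, which exhibits [b * ec] as a left multiple of [K]. *)
Lemma third_term_not_projective
    (I : min_injective_resolution (terwilliger_algebra F S x)) k :
  2%:R = 0 :> F -> swap k != k -> ~ projective_module (term I 2).
Proof.
move=> F2 neqk; have [q _ qK] := point_bij x; pose k0 := q x.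
have class0 m : (class m == ord0) = (m == k0).
  rewrite class_eqE srel0 inE /=.
  apply/eqP/eqP => [e | ->]; last by rewrite qK.
  by apply: (bij_inj (point_bij x)); rewrite qK.
have sum0 (f : 'I_n -> F) : \sum_(m | class m == ord0) f m = f k0.
  by rewrite (eq_bigl _ _ class0) big_pred1_eq.
have swap0 : swap k0 = k0.
  by apply/eqP; rewrite -class0 class_swap class0.
have addFF (c : F) : c + c = 0 by rewrite -mulr2n -mulr_natl F2 mul0r.
set c := class k.
have sumc (f : 'I_n -> F) : \sum_(m | class m == c) f m = f k + f (swap k).
  by rewrite (big_class x thinS) (negbTE neqk).
have cc : (class k == c) by [].
pose K : terwilliger_algebra F S x := Subvs (block_terwilliger ord0 c).
pose J : terwilliger_algebra F S x := Subvs (block_terwilliger c ord0).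
pose e : terwilliger_algebra F S x := Subvs (block_terwilliger ord0 ord0).
pose ec : terwilliger_algebra F S x := Subvs (dual_idempotent_terwilliger c).
have zeroE (b : terwilliger_algebra F S x) p r : b = 0 -> vsval b p r = 0.
  by move=> ->; rewrite mxE.
apply: (@third_term_not_projective_of_divisors _ I K J e ec).
- move=> b bK; apply/val_inj/matrixP => p r /=.
  have := zeroE _ p k bK; rewrite /= mulr_block sum0 cc mulr1 => b0.
  by rewrite mulr_block sum0 b0 mul0r mxE.
- move=> b bJ.
  (* The common value on class [i] of the columns of [b] in class [c]. *)
  pose col i := if [pick p | class p == i] is Some p then vsval b p k else 0.
  have b'T : \sum_i col i *: block i ord0 \in T.
    by apply: memv_suml => i _; rewrite memvZ ?block_terwilliger.
  exists (Subvs b'T); apply/val_inj/matrixP => p r /=.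
  rewrite mulr_dual_idempotent mulr_block sum0.
  have bsym u : vsval b u (swap k) = vsval b u k.
    have := zeroE _ u k0 bJ; rewrite /= mulr_block sumc class0 eqxx mulr1.
    by move/eqP; rewrite addr_eq0 => /eqP ->; apply/eqP; rewrite -addr_eq0 addFF.
  have -> : (\sum_i col i *: block i ord0) p k0 = vsval b p k.
    rewrite summxE (bigD1 (class p)) //= big1 => [|i neq].
      rewrite !mxE eqxx class0 eqxx mulr1 addr0 /col.
      case: pickP => [u /eqP/(classP thinS)[-> // | ->] | /(_ p)].
        by rewrite (terwilliger_swap _ _ (valP b)) bsym.
      by rewrite eqxx.
    by rewrite !mxE eq_sym (negbTE neq) mulr0.
  have [/eqP/(classP thinS)[-> | ->]|] := boolP (class r == c); rewrite ?mulr0 //.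
  by rewrite bsym.
- apply/val_inj/matrixP => p r /=; rewrite mulr_dual_idempotent mxE.
  by rewrite -natrM mulnb -andbA andbb.
- apply/val_inj/matrixP => p r /=; rewrite mulr_block sum0 !mxE !class0 eqxx.
  by rewrite andbT -natrM mulnb.
- apply/val_inj/matrixP => p r /=; rewrite mul_block sumc !mxE class_swap.
  by rewrite addFF mulr0.
- move=> t Jt; apply/val_inj/matrixP => p r /=.
  have := zeroE _ k r Jt; rewrite /= !mul_block !sum0 cc mul1r => ->.
  by rewrite mulr0 mxE.
move=> t /(congr1 (fun b : terwilliger_algebra F S x => vsval b k0 k0)) /=.
rewrite mul_block sumc class0 eqxx mul1r mxE class0 eqxx.
rewrite (terwilliger_swap _ _ (valP t)) swap0 addFF => /eqP.
by rewrite eq_sym oner_eq0.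
Qed.
End Matrices.

Theorem corollary2p13 (F : fieldType) (X : finType) (d : nat) (S : scheme X d)
    (x : X) (hS : quasi_thin S) :
  has_dominant_dimension (terwilliger_algebra F S x) None ->
  self_injective (terwilliger_algebra F S x).
Proof.
case=> I projI.
have [/forallP val0 | /forallPn[k]] :=
    boolP [forall k, (valency S (class S x k))%:R != 0 :> F].
  exact: self_injective_of_valency_neq0.
rewrite negbK (valency_class x hS) natrD => /eqP v0.
have neqk : swap S x k != k.
  by apply: contra_eqN v0 => ->; rewrite addr0 oner_eq0.
case: (third_term_not_projective (I := I) hS (k := k)) => //.
by rewrite -v0 neqk -natrD.
Qed.
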